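(* For all integers $m\ge 1$, $0\le r<m$ and $\ell\ge 0$ the following holds with a constant $C=C(\ell,m)>0$ depending only on $\ell$ and $m$. For every positive integer $n$, every Sidon set $S\subset[1,n]$ and every interval of integers $I\subset[1,n]$, $$\left|\sum_{\substack{a\in S\cap I\\ a\equiv r\ (\mathrm{mod}\ m)}} a^\ell-\frac{|S|}{n}\sum_{\substack{a\in I\\ a\equiv r\ (\mathrm{mod}\ m)}} a^\ell\right|\le C\,n^\ell\,\Phi(S,n)\log(2n).$$
   Context: $[1,n]$ denotes $\{1,2,\ldots,n\}$. A set $S\subset\mathbb{Z}$ is a Sidon set if all sums $a+b$, with $(a,b)\in S^2$ regarded as unordered pairs (with $a=b$ allowed), are distinct; i.e. $a+b=c+d$ with $a,b,c,d\in S$ implies $\{a,b\}=\{c,d\}$. An interval of integers is a set of consecutive integers. For a Sidon set $S\subset[1,n]$ define $$\Phi(S,n)=n^{1/2}\left(\left|1-\frac{|S|}{n^{1/2}}\right|+n^{-1/4}\right)^{1/2}.$$ *)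

(* Defs.v *)
From HB Require Import structures.
From mathcomp Require Import all_boot all_order all_algebra.
From mathcomp Require Import finmap.
From mathcomp Require Import all_classical all_reals all_analysis.

Set Implicit Arguments.
Unset Strict Implicit.
Unset Printing Implicit Defensive.

Import Order.TTheory GRing.Theory Num.Theory.

Local Open Scope fset_scope.
Local Open Scope ring_scope.

Definition sidon (S : {fset int}) : Prop :=
  forall a b c d : int, a \in S -> b \in S -> c \in S -> d \in S ->
    a + b = c + d -> [fset a; b] = [fset c; d].

(* The empty set counts as an interval. *)
Definition int_interval (I : {fset int}) : Prop :=
  forall a b c : int, a \in I -> c \in I -> a <= b <= c -> b \in I.

Definition sub_range (n : nat) (S : {fset int}) : Prop :=
  forall a : int, a \in S -> 1 <= a <= n%:Z.

Definition Phi (R : realType) (S : {fset int}) (n : nat) : R :=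
  Num.sqrt n%:R *
  Num.sqrt (`|1 - #|` S|%:R / Num.sqrt n%:R| + n%:R `^ (- 4^-1)).

(* Main.v *)
(** Let [K = #|S|], let [u] be of order [n^(3/4)] and let [A(x)] count the
    elements of [S] among [x, x - m, ..., x - (u-1)m].  Summed over
    [1 <= x <= n + um], [A] gives [uK]; since every nonzero difference has at
    most one representation in [S], [A^2] gives at most [uK + u^2].  So the
    total squared deviation of [A] from [uK/n] is
    [O_m(u^2 (|1 - K/sqrt n| + n^(-1/4)))], and by Cauchy-Schwarz the sum of the
    deviations over the [x <= q] with [x = r mod m] is [O_m(u Phi)].  Up to an
    edge term, [u] times the number of elements of [S] in an interval of length
    [um], that sum of [A] is [u] times the number of [a] in [S] with [a <= q]
    and [a = r mod m]; the edge term is [O(u sqrt(um))], again [O_m(u Phi)].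
    Differences of initial segments give intervals, and Abel summation
    introduces the weight [a^l].  The logarithm is only used through
    [ln (2n) >= ln 2]. *)

Require Import Defs.
From HB Require Import structures.
From mathcomp Require Import all_boot all_order all_algebra.
From mathcomp Require Import finmap.
From mathcomp Require Import all_classical all_reals all_analysis.
From mathcomp Require Import zify ring lra.

Set Implicit Arguments.
Unset Strict Implicit.
Unset Printing Implicit Defensive.

Import Order.TTheory GRing.Theory Num.Theory.

Local Open Scope nat_scope.

(** * Sidon sets in short windows *)

Definition sidon_pred (T : pred nat) : Prop :=
  forall a b c d, T a -> T b -> T c -> T d -> a + b = c + d -> a = c \/ a = d.

(** Pairs of distinct elements of the window are determined by their difference, which takes fewer
    than [2 * L] values; the diagonal pairs give the linear term. *)
Lemma sidon_window_count (T : pred nat) (p L : nat) :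
  sidon_pred T ->
  (\sum_(p <= a < p + L) T a) ^ 2 <= \sum_(p <= a < p + L) T a + 2 * L.
Proof.
move=> sT; set X := [set i : 'I_L | T (p + i)].
have -> : \sum_(p <= a < p + L) T a = #|X|.
  rewrite -{1}[p]add0n big_addn addKn big_mkord -sum1_card big_mkcond [RHS]big_mkcond /=.
  by apply: eq_bigr => i _; rewrite inE addnC; case: (T _).
pose Y := [set z in finset.setX X X | z.1 != z.2].
have subXX : finset.setX X X \subset [set (i, i) | i in X] :|: Y.
  apply/fintype.subsetP => -[i j]; rewrite !inE /= => /andP[Xi Xj].
  have [<-|_] := eqVneq i j; last by rewrite Xi Xj orbT.
  by rewrite imset_f // inE.
rewrite -mulnn -cardsX (leq_trans (subset_leq_card subXX)) //.
rewrite (leq_trans (leq_card_setU _ _)) // leq_add ?leq_imset_card //.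
have ltd (z : 'I_L * 'I_L) : z.1 + L - z.2 < 2 * L.
  by have := ltn_ord z.1; have := ltn_ord z.2; lia.
rewrite -[leqRHS]card_ord -(@card_in_imset _ _ (fun z => Ordinal (ltd z)) Y).
  exact: max_card.
move=> [a b] [c d]; rewrite !inE /= => /andP[/andP[Ta Tb] ab] /andP[/andP[Tc Td] cd].
move=> /(congr1 val)/= e.
have := ltn_ord a; have := ltn_ord b; have := ltn_ord c; have := ltn_ord d => *.
have abn : (a : nat) != b by [].
have [||] := sT (p + a) (p + d) (p + c) (p + b) Ta Td Tc Tb.
- by lia.
- move=> ac; suff: (b : nat) = d /\ (a : nat) = c.
    by move=> [/val_inj -> /val_inj ->].
  by lia.
- by move=> ?; move: abn; lia.
Qed.

(** * Moments of the window counts and their link to prefix counts *)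

(* If [T 0 = false], the truncation in [x - j * m] is harmless. *)
Definition window_count (T : pred nat) (m u x : nat) : nat :=
  \sum_(j < u) T (x - j * m).

Section Windows.
Variables (T : pred nat) (m n : nat).
Hypotheses (m_gt0 : 0 < m) (T0 : T 0 = false) (Tn : forall a, T a -> a <= n).

Lemma sum_shift (P : pred nat) (d q : nat) :
  (forall x, P (x + d) = P x) ->
  \sum_(1 <= x < q.+1 | P x) T (x - d) = \sum_(1 <= x < (q - d).+1 | P x) T x.
Proof.
move=> Pd; have [dq|qd] := leqP d q; last first.
  rewrite big_nat_cond big1 ?[RHS]big_geq //; first by lia.
  by move=> x /andP[/andP[_ xq] _]; rewrite (_ : x - d = 0) ?T0 //; lia.
rewrite (big_cat_nat (n := d.+1)) //= big_nat_cond big1 ?add0n; last first.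
  by move=> x /andP[/andP[_ xq] _]; rewrite (_ : x - d = 0) ?T0 //; lia.
rewrite -add1n big_addn subSn //.
by apply: eq_big => x; rewrite ?Pd ?addnK.
Qed.

Lemma sum_past_n (M : nat) : n <= M ->
  \sum_(1 <= x < M.+1) T x = \sum_(1 <= x < n.+1) T x.
Proof.
move=> nM; rewrite (big_cat_nat (n := n.+1)) //= -[RHS]addn0; congr addn.
rewrite big_nat_cond big1 // => x /andP[/andP[nx _] _].
by case: (boolP (T x)) => // /Tn; lia.
Qed.

Lemma window_first_moment (u : nat) :
  \sum_(1 <= x < (n + u * m).+1) window_count T m u x
  = u * \sum_(1 <= x < n.+1) T x.
Proof.
rewrite exchange_big /=; under eq_bigr => j _.
  rewrite (@sum_shift xpredT) // sum_past_n; last first.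
    by have := leq_mul (ltnW (ltn_ord j)) (leqnn m); lia.
  over.
by rewrite sum_nat_const card_ord.
Qed.

Lemma sum_nat_le1 (P : pred nat) (s t : nat) :
  (forall x y, P x -> P y -> x = y) -> \sum_(s <= x < t) P x <= 1.
Proof.
move=> uP; have [/hasP[x xs Px]|/hasPn nP] := boolP (has P (index_iota s t)).
  rewrite (bigD1_seq x) ?iota_uniq //= Px big1_seq ?addn0 // => y /andP[yx _].
  by case: (boolP (P y)) => // Py; rewrite (uP _ _ Py Px) eqxx in yx.
by rewrite big1_seq // => x /andP[_ /nP /negPf ->].
Qed.

(** Expand the square into pairs of shifts [(j, k)]. For each [j] the diagonal contributes the size
    of [T], and each [k != j] at most 1: a hit [x] exhibits the nonzero difference [(k - j)m], which
    has at most one representation. *)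
Lemma window_second_moment (u : nat) : sidon_pred T ->
  \sum_(1 <= x < (n + u * m).+1) window_count T m u x ^ 2
  <= u * \sum_(1 <= x < n.+1) T x + u ^ 2.
Proof.
move=> sT; set K := \sum_(1 <= x < n.+1) T x.
have jle (j : 'I_u) : n <= n + u * m - j * m.
  by have := leq_mul (ltnW (ltn_ord j)) (leqnn m); lia.
under eq_bigr => x _ do rewrite -mulnn big_distrlr /=.
rewrite exchange_big /=.
have rowle (j : 'I_u) : \sum_(1 <= x < (n + u * m).+1) \sum_(k < u)
    T (x - j * m) * T (x - k * m) <= K + u.
  rewrite exchange_big (bigD1 j) //= leq_add //.
    under eq_bigr => x _ do rewrite mulnb andbb.
    by rewrite (@sum_shift xpredT) // sum_past_n.
  rewrite (@leq_trans (\sum_(k < u | k != j) 1)) //; last first.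
    by rewrite sum1_card -[leqRHS](card_ord u) max_card.
  apply: leq_sum => k kj; under eq_bigr => x _ do rewrite mulnb.
  apply: (@sum_nat_le1 (fun x => T (x - j * m) && T (x - k * m))) => x y /= /andP[xj xk] /andP[yj yk].
  (* Elements of [T] are positive, so at a hit neither subtraction is truncated. *)
  have pos z : T z -> 0 < z by case: z => //; rewrite T0.
  have := pos _ xj; have := pos _ xk; have := pos _ yj; have := pos _ yk => *.
  have kjm : (k * m == j * m) = false.
    by rewrite eqn_pmul2r //; apply/negbTE.
  by have [||] := sT _ _ _ _ xj yk yj xk; lia.
apply: (@leq_trans (\sum_(j < u) (K + u))); first exact: leq_sum.
by rewrite sum_nat_const card_ord mulnDr -mulnn.
Qed.

(** Shifts by [j * m] preserve the residue class, so [Z] counts each [a] once for every [j] with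
    [a + j * m <= q]. For a given [j], the elements missed lie in [(q - j * m, q]], hence among
    those counted by [W]. *)
Lemma window_prefix (r q u : nat) :
  let N := \sum_(1 <= a < q.+1 | a == r %[mod m]) T a in
  let W := \sum_(q.+1 - u * m <= a < q.+1) T a in
  let Z := \sum_(1 <= x < q.+1 | x == r %[mod m]) window_count T m u x in
  Z <= u * N /\ u * N <= Z + u * W.
Proof.
move=> N W Z.
have ZE : Z = \sum_(j < u) \sum_(1 <= a < (q - j * m).+1 | a == r %[mod m]) T a.
  rewrite /Z exchange_big; apply: eq_bigr => j _; apply: sum_shift => x.
  by rewrite addnC modnMDl.
have split_N (j : 'I_u) : N = \sum_(1 <= a < (q - j * m).+1 | a == r %[mod m]) T a
    + \sum_((q - j * m).+1 <= a < q.+1 | a == r %[mod m]) T a.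
  by rewrite /N (big_cat_nat (n := (q - j * m).+1)) //=; lia.
have uE (c : nat) : u * c = \sum_(j < u) c by rewrite sum_nat_const card_ord.
rewrite ZE !uE -big_split /=; split; apply: leq_sum => j _.
  by rewrite (split_N j) leq_addr.
rewrite {1}(split_N j) leq_add2l.
have lejm : j * m <= u * m by rewrite leq_mul // ltnW.
rewrite /W (big_cat_nat (n := (q - j * m).+1) (m := q.+1 - u * m)) //=; [|by lia|by lia].
rewrite (leq_trans _ (leq_addl _ _)) // big_mkcond; apply: leq_sum => a _.
by case: ifP.
Qed.

End Windows.

Local Open Scope fset_scope.
Local Open Scope ring_scope.

(** * Cauchy-Schwarz, Abel summation and the numerical variance bound *)

Lemma sqr_sum_le (R : realFieldType) (I : Type) (s : seq I) (f : I -> R) :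
  (\sum_(i <- s) f i) ^+ 2 <= (size s)%:R * \sum_(i <- s) f i ^+ 2.
Proof.
case: s => [|i0 s]; first by rewrite !big_nil mul0r expr0n.
set t := i0 :: s; set S := \sum_(i <- t) f i; set q : R := (size t)%:R.
have q0 : 0 < q by rewrite ltr0n.
suff : 0 <= \sum_(i <- t) f i ^+ 2 - S ^+ 2 / q.
  by rewrite subr_ge0 ler_pdivrMr // mulrC.
suff <- : \sum_(i <- t) (f i - S / q) ^+ 2 = \sum_(i <- t) f i ^+ 2 - S ^+ 2 / q.
  by apply: sumr_ge0 => i _; exact: sqr_ge0.
under eq_bigr => i _ do rewrite sqrrB.
rewrite big_split sumrB /= sumrMnl -mulr_suml -/S big_const_seq count_predT.
rewrite iter_addr_0 -[(_ ^+ 2) *+ size t]mulr_natr -/q.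
by field; rewrite gt_eqF.
Qed.

Lemma abel_sum_le (R : realDomainType) (w g : nat -> R) (B : R) (n : nat) :
  {homo w : a b / (a <= b)%N >-> a <= b} -> 0 <= w 0 ->
  (forall q, (q <= n)%N -> `|\sum_(1 <= a < q.+1) g a| <= B) ->
  `|\sum_(1 <= a < n.+1) w a * g a| <= 2 * B * w n.
Proof.
move=> w_homo w0 gB.
have B0 : 0 <= B by apply: le_trans (gB 0%N _); rewrite ?normr_ge0.
have wge0 a : 0 <= w a by apply: le_trans w0 _; exact: w_homo.
(* The difference inside the norm is the sum of the increments of [w] times earlier prefix sums. The
   increments are nonnegative, so the bounds telescope; the boundary term [w n * G] later costs a
   second [B * w n]. *)
have abel q : (q <= n)%N ->
    `|w q * \sum_(1 <= a < q.+1) g a - \sum_(1 <= a < q.+1) w a * g a| <= B * w q.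
  elim: q => [_|q IH qn].
    by rewrite !big_geq // mulr0 subr0 normr0 mulr_ge0.
  rewrite !(big_nat_recr q.+1) //=.
  set G := \sum_(1 <= a < q.+1) g a; set H := \sum_(1 <= a < q.+1) w a * g a.
  have -> : w q.+1 * (G + g q.+1) - (H + w q.+1 * g q.+1)
      = (w q * G - H) + (w q.+1 - w q) * G by ring.
  have dw : 0 <= w q.+1 - w q by rewrite subr_ge0 w_homo.
  rewrite (le_trans (ler_normD _ _)) // normrM (ger0_norm dw).
  have -> : B * w q.+1 = B * w q + (w q.+1 - w q) * B by ring.
  by rewrite lerD ?IH ?ler_wpM2l ?gB ?(ltnW qn) // ltnW.
have /abel := leqnn n; have := gB _ (leqnn n).
set G := \sum_(1 <= a < n.+1) g a; set H := \sum_(1 <= a < n.+1) w a * g a => GB.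
rewrite distrC => HB; rewrite -[H](subrK (w n * G)).
rewrite (le_trans (ler_normD _ _)) // normrM (ger0_norm (wge0 n)).
have -> : 2 * B * w n = B * w n + w n * B by ring.
by rewrite lerD // ler_wpM2l.
Qed.

(* Meant for [w = n^(1/4)]; the left-hand side is the bound of [window_variance]. *)
Lemma variance_bound (R : realFieldType) (w K m u : R) :
  1 <= w -> 0 <= K -> K <= 2 * w ^+ 2 -> 1 <= m -> w ^+ 3 <= u -> u <= 2 * w ^+ 3 ->
  u * K + u ^+ 2 - u ^+ 2 * K ^+ 2 / w ^+ 4 + m * u ^+ 3 * K ^+ 2 / w ^+ 8
  <= u ^+ 2 * (10 * m * (`|1 - K / w ^+ 2| + w^-1)).
Proof.
move=> w1 K0 Kw m1 wu uw.
have w0 : 0 < w by lra.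
have u0 : 0 < u by apply: lt_le_trans wu; rewrite exprn_gt0.
(* Normalise so that [s] and [v] are bounded. The main terms become [(1 - s)(1 + s)], and the two
   lower-order terms carry a factor [w^-1]. *)
pose s := K / w ^+ 2.
have Ks : K = s * w ^+ 2 by rewrite /s; field; rewrite gt_eqF.
have s0 : 0 <= s by rewrite divr_ge0 // ltW ?exprn_gt0.
have s2 : s <= 2 by rewrite ler_pdivrMr ?exprn_gt0.
pose v := u / w ^+ 3.
have uv : u = v * w ^+ 3 by rewrite /v; field; rewrite gt_eqF.
have v1 : 1 <= v by rewrite ler_pdivlMr ?exprn_gt0 // mul1r.
have v2 : v <= 2 by rewrite ler_pdivrMr ?exprn_gt0.
rewrite -/s.
have -> : u * K + u ^+ 2 - u ^+ 2 * K ^+ 2 / w ^+ 4 + m * u ^+ 3 * K ^+ 2 / w ^+ 8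
   = u ^+ 2 * ((s / v + m * v * s ^+ 2) * w^-1 + (1 - s) * (1 + s)).
  by rewrite Ks uv; field; rewrite !gt_eqF //; lra.
rewrite ler_wpM2l ?sqr_ge0 // [leRHS]mulrDr [leLHS]addrC; apply: lerD.
  apply: (@le_trans _ _ (`|1 - s| * 3)).
    apply: (@le_trans _ _ (`|1 - s| * (1 + s))).
      by rewrite ler_wpM2r ?ler_norm //; lra.
    by rewrite ler_wpM2l //; lra.
  by rewrite mulrC ler_wpM2r //; lra.
(* Here [s / v + m * v * s ^+ 2 <= 2 + 8 * m <= 10 * m], which fixes the constant. *)
rewrite ler_wpM2r ?invr_ge0 ?(ltW w0) //.
have : s / v <= 2 by rewrite ler_pdivrMr; lra.
have : s ^+ 2 <= 4 by nra.
have := sqr_ge0 s; set S2 := s ^+ 2 => S0 S4 ?.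
have : v * S2 <= 8 by nra.
rewrite -subr_ge0 => ?.
have : 0 <= m * (8 - v * S2) by rewrite mulr_ge0 //; lra.
by lra.
Qed.

(** * Variance of the window counts and discrepancy of prefixes *)

(** Expand around [u K / n] and insert both moments. The last term is the cost of the [u * m]
    positions [x] beyond [n]. *)
Lemma window_variance (R : realFieldType) (T : pred nat) (m n u : nat) (K : R) :
  (0 < m)%N -> (0 < n)%N -> T 0%N = false -> (forall a, T a -> (a <= n)%N) ->
  sidon_pred T ->
  K = (\sum_(1 <= a < n.+1) T a)%:R ->
  \sum_(1 <= x < (n + u * m).+1)
    ((window_count T m u x)%:R - u%:R * K / n%:R : R) ^+ 2
  <= u%:R * K + u%:R ^+ 2 - u%:R ^+ 2 * K ^+ 2 / n%:R
     + m%:R * u%:R ^+ 3 * K ^+ 2 / n%:R ^+ 2.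
Proof.
move=> m0 n0 T0 Tn sT KE.
have nR : 0 < n%:R :> R by rewrite ltr0n.
under eq_bigr => x _ do rewrite sqrrB.
have M2 : \sum_(1 <= x < (n + u * m).+1) (window_count T m u x)%:R ^+ 2
    <= u%:R * K + u%:R ^+ 2 :> R.
  under eq_bigr => x _ do rewrite -natrX.
  by rewrite KE -natr_sum -natrX -natrM -natrD ler_nat window_second_moment.
have M1 : \sum_(1 <= x < (n + u * m).+1) (window_count T m u x)%:R = u%:R * K :> R.
  by rewrite KE -natr_sum window_first_moment // natrM.
rewrite big_split sumrB /= sumrMnl -mulr_suml M1 sumr_const_nat subn1 /=.
rewrite -[(_ ^+ 2) *+ _]mulr_natr natrD natrM.
set Q := \sum_(1 <= x < _) _ in M2 *.
have -> : Q - u%:R * K * (u%:R * K / n%:R) *+ 2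
    + (u%:R * K / n%:R) ^+ 2 * (n%:R + u%:R * m%:R)
  = Q - u%:R ^+ 2 * K ^+ 2 / n%:R + m%:R * u%:R ^+ 3 * K ^+ 2 / n%:R ^+ 2.
  by field; rewrite gt_eqF.
by lra.
Qed.

Lemma sidon_window_sqr_le (T : pred nat) (q L : nat) :
  sidon_pred T -> (0 < L)%N -> ((\sum_(q - L <= a < q) T a) ^ 2 <= 4 * L)%N.
Proof.
move=> sT L0.
have le_q : (q <= q - L + L)%N by lia.
apply: (@leq_trans ((\sum_(q - L <= a < q - L + L) T a) ^ 2)).
  rewrite leq_exp2r // [leqRHS](big_cat_nat (leq_subr L q) le_q) /=.
  exact: leq_addr.
(* For a count [W >= 2], [W <= W ^ 2 / 2] absorbs the linear term; for [W <= 1], [L > 0]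
   suffices. *)
have := sidon_window_count (q - L) L sT.
by set W := (\sum_(_ <= a < _) T a)%N; rewrite -mulnn; nia.
Qed.

(** Taking [w] as the inverse of the power occurring in [Phi] turns that term into [w^-1], so later
    estimates are rational in [w]. *)
Lemma fourth_root_inv (R : realType) (n : nat) : (0 < n)%N ->
  let w : R := (n%:R `^ (- 4^-1))^-1 in
  [/\ 1 <= w, w ^+ 4 = n%:R & Num.sqrt n%:R = w ^+ 2].
Proof.
move=> n0 w.
have nR : 1 <= n%:R :> R by rewrite ler1n.
have w0 : 0 < w by rewrite invr_gt0 powR_gt0 // ltr0n.
have w4 : w ^+ 4 = n%:R.
  rewrite exprVn -powR_mulrn ?powR_ge0 // -powRrM mulNr mulVf ?pnatr_eq0 //.
  by rewrite powR_inv1 ?ler0n // invrK.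
split=> //; last by rewrite -w4 (exprM w 2 2) sqrtr_sqr ger0_norm // exprn_ge0 // ltW.
by rewrite -(@expr_ge1 _ 4) // ?w4 // ltW.
Qed.

Lemma residue_prefix_discrepancy (R : realType) (T : pred nat) (m n r q : nat) (K : R) :
  (0 < m)%N -> (0 < n)%N -> T 0%N = false -> (forall a, T a -> (a <= n)%N) ->
  sidon_pred T -> (q <= n)%N ->
  K = (\sum_(1 <= a < n.+1) T a)%:R ->
  `|\sum_(1 <= a < q.+1 | a == r %[mod m]) ((T a)%:R - K / n%:R)|
  <= 7 * m%:R * (Num.sqrt n%:R *
       Num.sqrt (`|1 - K / Num.sqrt n%:R| + n%:R `^ (- 4^-1))).
Proof.
move=> m0 n0 T0 Tn sT qn KE.
have /= [] := fourth_root_inv R n0; rewrite -[X in _ + X]invrK.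
set w := (_ `^ _)^-1 => w1 w4 ->; set t := `|_| + _.
have w0 : 0 < w by lra.
have t0 : 0 <= t by rewrite addr_ge0 // invr_ge0 ltW.
have mR : 1 <= m%:R :> R by rewrite ler1n.
(* This is [Phi]; from here on only [F0] and [F2] are used about it. *)
set F := w ^+ 2 * Num.sqrt t.
have F0 : 0 <= F by rewrite mulr_ge0 ?sqrtr_ge0 // exprn_ge0 // ltW.
have F2 : F ^+ 2 = n%:R * t by rewrite exprMn sqr_sqrtr // -w4 -exprM.
clearbody F.
have w31 : 1 <= w ^+ 3 by rewrite expr_ge1 // ltW.
have [u [u1 u2]] : exists u : nat, w ^+ 3 <= u%:R /\ u%:R <= 2 * w ^+ 3.
  exists (Num.truncn (w ^+ 3)).+1.
  have /truncn_itv /andP[h1 h2] : 0 <= w ^+ 3 by lra.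
  by split; rewrite ?(ltW h2) // -natr1; lra.
have u0 : 0 < u%:R :> R by lra.
have K0 : 0 <= K by rewrite KE ler0n.
have Kw : K <= 2 * w ^+ 2.
  rewrite -(@ler_pXn2r _ 2) // ?nnegrE ?mulr_ge0 ?exprn_ge0 ?(ltW w0) //.
  rewrite exprMn -exprM w4 KE -!natrX -natrM ler_nat.
  by have := sidon_window_sqr_le n.+1 sT n0; rewrite subSnn.
set D := \sum_(_ <= _ < _ | _) _.
set N := (\sum_(1 <= a < q.+1 | a == r %[mod m]) T a)%N.
set W := (\sum_(q.+1 - u * m <= a < q.+1) T a)%N.
set Z := (\sum_(1 <= x < q.+1 | x == r %[mod m]) window_count T m u x)%N.
pose X : R := \sum_(1 <= x < q.+1 | x == r %[mod m])
  ((window_count T m u x)%:R - u%:R * K / n%:R).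
have [ZN NZ] : (Z <= u * N)%N /\ (u * N <= Z + u * W)%N by exact: window_prefix.
have XD : u%:R * D = X + ((u * N)%:R - Z%:R).
  rewrite /D /X !sumrB -!natr_sum -/N -/Z natrM mulrBr mulr_sumr.
  by under eq_bigr do rewrite mulrA; lra.
have X_le : `|X| <= u%:R * (4 * m%:R * F).
  rewrite -(@ler_pXn2r _ 2) ?nnegrE ?normr_ge0 ?mulr_ge0 ?ler0n ?F0 //.
  rewrite real_normK ?num_real //.
  (* The factor [n] bounds the number of terms of [X], the rest their squared sum. Then
     [10 * m <= 16 * m ^ 2] makes the bound a perfect square. *)
  have /le_trans -> // : X ^+ 2 <= n%:R * (u%:R ^+ 2 * (10 * m%:R * t)).
    rewrite /X -big_filter (le_trans (sqr_sum_le _ _)) //.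
    apply: ler_pM; rewrite ?ler0n ?sumr_ge0 //.
    - by move=> *; exact: sqr_ge0.
    - by rewrite ler_nat (leq_trans _ qn) // size_filter (leq_trans (count_size _ _)) // size_iota subn1.
    have V := window_variance u m0 n0 T0 Tn sT KE.
    have := variance_bound w1 K0 Kw mR u1 u2; rewrite -/t.
    rewrite w4 (_ : w ^+ 8 = n%:R ^+ 2); last by rewrite -w4 -exprM.
    apply: le_trans; apply: le_trans V.
    have qM : (q < (n + u * m).+1)%N by rewrite ltnS (leq_trans qn) ?leq_addr.
    (* Squares are nonnegative, so the class up to [q] may be enlarged to the whole range of the
       variance. *)
    rewrite big_filter [leRHS](big_cat_nat (ltn0Sn q) qM) /=.
    rewrite -[leLHS]addr0 lerD ?sumr_ge0 //; last by move=> *; exact: sqr_ge0.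
    by rewrite big_mkcond ler_sum // => x _; case: ifP => // _; exact: sqr_ge0.
  have -> : (u%:R * (4 * m%:R * F)) ^+ 2 = n%:R * (u%:R ^+ 2 * (16 * m%:R ^+ 2 * t)).
    by rewrite !exprMn F2; ring.
  rewrite !ler_wpM2l ?ler0n ?sqr_ge0 // ler_wpM2r // expr2.
  by nra.
have W_le : W%:R <= 3 * m%:R * F.
  rewrite -(@ler_pXn2r _ 2) // ?nnegrE ?mulr_ge0 ?ler0n ?F0 //.
  have W2 : (W ^ 2 <= 4 * (u * m))%N.
    have um0 : (0 < u * m)%N by rewrite muln_gt0 m0 -(ltr0n R) u0.
    exact: sidon_window_sqr_le.
  rewrite -natrX; apply: le_trans (_ : (4 * (u * m))%:R <= _).
    by rewrite ler_nat.
  rewrite exprMn F2 !natrM.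
  (* The summand [w^-1] of [t] pays for the edge: [W ^ 2 <= 4 * u * m <= 8 * m * n * t <= (3 * m *
     F) ^ 2]. *)
  have wt : w ^+ 3 <= n%:R * t.
    have -> : w ^+ 3 = n%:R * w^-1 by rewrite -w4; field; rewrite gt_eqF.
    by rewrite ler_wpM2l ?ler0n // lerDr.
  have ? : u%:R <= 2 * (n%:R * t) by lra.
  have ? : 0 <= n%:R * t by rewrite mulr_ge0 ?ler0n.
  have -> : (3 * m%:R) ^+ 2 * (n%:R * t) = (9 * m%:R * (n%:R * t)) * m%:R by ring.
  rewrite mulrA ler_wpM2r ?ler0n //.
  by nra.
have E_le : `|(u * N)%:R - Z%:R : R| <= u%:R * W%:R.
  by rewrite -natrB // ger0_norm ?ler0n // -natrM ler_nat leq_subLR.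
rewrite -(ler_pM2l u0) -[X in X * `|_|](gtr0_norm u0) -normrM XD.
rewrite (le_trans (ler_normD _ _)) //.
have -> : 7 * m%:R * F = 4 * m%:R * F + 3 * m%:R * F by ring.
rewrite mulrDr lerD // (le_trans E_le) // ler_wpM2l // ltW.
Qed.

(** * From prefixes to intervals *)

Lemma convex_pred_interval (J : pred nat) (q : nat) :
  (forall a b c, (0 < a)%N -> (c <= q)%N -> J a -> J c -> (a <= b <= c)%N -> J b) ->
  exists p p', [/\ (p <= p')%N, (p' <= q)%N &
    forall a, (1 <= a <= q)%N -> J a = (p < a <= p')%N].
Proof.
elim: q => [|q IH] cJ; first by exists 0%N, 0%N; split=> // a; lia.
have [|p [p' [pp' p'q JE]]] := IH; first by move=> a b c a0 cq; apply: cJ => //; lia.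
have split_le a : (1 <= a <= q.+1)%N -> (1 <= a <= q)%N \/ a = q.+1 by lia.
have [Jq|nJq] := boolP (J q.+1); last first.
  exists p, p'; split=> //; first by lia.
  by move=> a /split_le[/JE //|->]; rewrite (negPf nJq); lia.
(* If [p = p'], nothing below [q.+1] was in [J] and the interval starts afresh at [q.+1]; otherwise
   convexity fills the gap from [p.+1] to [q.+1]. *)
have [pE|ltp] := eqVneq p p'.
  exists q, q.+1; split=> // a /split_le[aq|->]; last by rewrite Jq; lia.
  by rewrite JE //; lia.
exists p, q.+1; split=> //; first by lia.
move=> a /split_le[aq|->]; last by rewrite Jq; lia.
have Jp : J p.+1 by rewrite JE; lia.
have [pa|ap] := ltnP p a; last by rewrite JE //; lia.
by rewrite (cJ p.+1 a q.+1) //; lia.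
Qed.

Lemma convex_sum_le (R : realDomainType) (J : pred nat) (g : nat -> R) (B : R) (n : nat) :
  (forall a b c, (0 < a)%N -> J a -> J c -> (a <= b <= c)%N -> J b) ->
  (forall q, (q <= n)%N -> `|\sum_(1 <= a < q.+1) g a| <= B) ->
  forall q, (q <= n)%N -> `|\sum_(1 <= a < q.+1 | J a) g a| <= 2 * B.
Proof.
move=> cJ gB q qn.
have [|p [p' [pp' p'q JE]]] := @convex_pred_interval J q.
  by move=> a b c a0 _; exact: cJ.
have -> : \sum_(1 <= a < q.+1 | J a) g a
    = \sum_(1 <= a < p'.+1) g a - \sum_(1 <= a < p.+1) g a.
  rewrite [X in _ = X - _](big_cat_nat (n := p.+1)) //= addrAC subrr add0r.
  rewrite big_nat_cond (eq_bigl (fun a => (1 <= a < q.+1) && (p < a <= p'))%N); last first.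
    by move=> a; case: (boolP (1 <= a < q.+1)%N) => //= aq; rewrite JE.
  rewrite -big_nat_cond (big_cat_nat (n := p.+1)) //=; last by lia.
  rewrite [X in X + _]big_nat_cond big1 ?add0r; last by move=> a; lia.
  rewrite (big_cat_nat (n := p'.+1)) //=.
  rewrite [X in _ + X]big_nat_cond [X in _ + X]big1 ?addr0; last by move=> a; lia.
  rewrite big_nat_cond [RHS]big_nat_cond; apply: eq_bigl => a; lia.
rewrite (le_trans (ler_normB _ _)) // mulr_natl mulr2n lerD // gB //; lia.
Qed.

(** * Transfer to finite sets of integers and conclusion *)

Lemma big_fset_sub_range (V : zmodType) (n : nat) (X : {fset int})
    (P : pred int) (F : int -> V) : sub_range n X ->
  \sum_(a <- X | P a) F a
  = \sum_(1 <= a < n.+1 | P a%:Z) (if a%:Z \in X then F a%:Z else 0).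
Proof.
move=> Xn; rewrite -big_mkcondr /=.
rewrite (perm_big [seq a%:Z | a <- index_iota 1 n.+1 & a%:Z \in X]); last first.
  apply: uniq_perm; rewrite ?fset_uniq // ?map_inj_uniq ?filter_uniq ?iota_uniq //.
    by move=> a b [].
  move=> a; apply/idP/mapP => [aX|[b]]; last by rewrite mem_filter => /andP[? _] ->.
  have := Xn a aX; case: a aX => // a aX a1n; exists a => //.
  by rewrite mem_filter aX mem_index_iota; lia.
by rewrite big_map big_filter_cond; apply: eq_bigl => a; rewrite andbC.
Qed.

Lemma sidon_sidon_pred (S : {fset int}) : sidon S -> sidon_pred (fun a : nat => a%:Z \in S).
Proof.
move=> sS a b c d Sa Sb Sc Sd e.
have /fsetP/(_ a%:Z) : [fset a%:Z; b%:Z] = [fset c%:Z; d%:Z].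
  by apply: sS => //; lia.
by rewrite !inE eqxx /= => /esym /orP[]/eqP[]; auto.
Qed.

Theorem corollary2 (R : realType) (m l : nat) (hm : (1 <= m)%N) :
  exists C : R, 0 < C /\
    forall (r n : nat) (S I : {fset int}),
      (r < m)%N -> (0 < n)%N ->
      sub_range n S -> sidon S ->
      sub_range n I -> int_interval I ->
      `| \sum_(a <- S `&` I | (a == r%:Z %[mod m%:Z])%Z) a%:~R ^+ l
         - #|` S|%:R / n%:R
           * \sum_(a <- I | (a == r%:Z %[mod m%:Z])%Z) a%:~R ^+ l |
      <= C * n%:R ^+ l * Phi R S n * ln (2 * n%:R).
Proof.
have ln2 : 0 < ln 2 :> R by rewrite ln_gt0 // ltr1n.
have mR : 0 < m%:R :> R by rewrite ltr0n.
(* The constant is 7 for a prefix, doubled for an interval and doubled again by Abel summation. *)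
exists (28 * m%:R / ln 2); split; first by rewrite divr_gt0 // mulr_gt0.
move=> r n S I _ n0 Sn sS In cI.
pose T := [pred a : nat | a%:Z \in S]; pose J := [pred a : nat | a%:Z \in I].
set K : R := #|` S|%:R.
have KE : K = (\sum_(1 <= a < n.+1) T a)%:R.
  rewrite /K -sum1_size natr_sum (big_fset_sub_range _ _ Sn) natr_sum.
  by apply: eq_bigr => a _; rewrite /T /=; case: ifP.
have T0 : T 0%N = false by apply/negbTE/negP => /Sn; lia.
have Tn a : T a -> (a <= n)%N by move=> /Sn; lia.
have cJ a b c : (0 < a)%N -> J a -> J c -> (a <= b <= c)%N -> J b.
  by move=> _ Ja Jc abc; apply: (cI a b c) => //; lia.
pose B := 7 * m%:R * Phi R S n.
pose g (a : nat) : R := if a == r %[mod m] then (T a)%:R - K / n%:R else 0.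
have gB q : (q <= n)%N -> `|\sum_(1 <= a < q.+1) g a| <= B.
  move=> qn; rewrite -big_mkcond /=.
  exact: (residue_prefix_discrepancy r hm n0 T0 Tn (sidon_sidon_pred sS) qn KE).
(* The conditions on residue and interval are moved into the summand, leaving plain prefix sums for
   Abel summation. *)
pose g' (a : nat) : R := if J a then g a else 0.
have gB' q : (q <= n)%N -> `|\sum_(1 <= a < q.+1) g' a| <= 2 * B.
  by move=> qn; rewrite -big_mkcond; exact: convex_sum_le gB q qn.
have IS : sub_range n (S `&` I) by move=> a; rewrite inE => /andP[/Sn].
have modE (a : nat) : (a%:Z == r%:Z %[mod m%:Z])%Z = (a == r %[mod m]).
  by rewrite !modz_nat.
have -> : \sum_(a <- S `&` I | (a == r%:Z %[mod m%:Z])%Z) a%:~R ^+ l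
         - K / n%:R * \sum_(a <- I | (a == r%:Z %[mod m%:Z])%Z) a%:~R ^+ l
  = \sum_(1 <= a < n.+1) a%:R ^+ l * g' a.
  rewrite (big_fset_sub_range _ _ IS) (big_fset_sub_range _ _ In) mulr_sumr -sumrB.
  rewrite big_mkcond; apply: eq_bigr => a _; rewrite modE inE /g' /g /T /J /=.
  case: (boolP (a == r %[mod m])) => _; last by rewrite if_same mulr0.
  by case: (a%:Z \in S); case: (a%:Z \in I) => /=; rewrite ?pmulrn; ring.
have w_homo : {homo (fun a : nat => a%:R ^+ l : R) : a b / (a <= b)%N >-> a <= b}.
  by move=> a b ab; rewrite lerXn2r ?nnegrE ?ler0n ?ler_nat.
rewrite (le_trans (abel_sum_le w_homo _ gB')) ?exprn_ge0 //.
have Phi0 : 0 <= Phi R S n by rewrite mulr_ge0 ?sqrtr_ge0.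
have -> : 2 * (2 * B) * n%:R ^+ l = 28 * m%:R * n%:R ^+ l * Phi R S n by rewrite /B; ring.
have -> : 28 * m%:R / ln 2 * n%:R ^+ l * Phi R S n * ln (2 * n%:R)
  = 28 * m%:R * n%:R ^+ l * Phi R S n * (ln (2 * n%:R) / ln 2).
  by field; rewrite gt_eqF.
rewrite ler_peMr ?mulr_ge0 ?exprn_ge0 ?ler0n // ler_pdivlMr // mul1r.
by rewrite ler_ln ?posrE ?mulr_gt0 ?ltr0n // ler_peMr // ler1n.
Qed.
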